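(* Let $p$ be an odd prime and for $q\in\{1,\dots,(p-1)/2\}$ let $\omega_{p/q}=e^{2\pi i q/p}$. Let $G'$ be an all-regular substructure of an oriented graph that contains no $p$-vanishing unicyclic component, and let $n_\ast$ be the number of (necessarily non-$p$-vanishing) unicyclic components of $G'$. Then $$\prod_{q=1}^{(p-1)/2}\det L_{\omega_{p/q}}(G')=p^{\,n_\ast},\qquad\text{i.e. } n_\ast=\log_p\Big(\prod_{q=1}^{(p-1)/2}\det L_{\omega_{p/q}}(G')\Big).$$
   Context: An oriented graph $G=(V,E)$ is a finite directed graph with no loops, no multiple arcs, and no pair of opposite arcs. A substructure is $(V',E')$ with $V'\subseteq V$, $E'\subseteq E$ (arcs may leave $V'$); for $|\omega|=1$ its Hermitian Laplacian $L_\omega((V',E'))$ is the $V'\times V'$ matrix with diagonal entry at $u$ the number of arcs of $E'$ incident with $u$, and $(u,v)$ entry ($u\ne v$) $-\omega$ if some arc of $E'$ goes $u\to v$, $-\overline\omega$ if some arc of $E'$ goes $v\to u$, $0$ otherwise. Its connected components are the classes $V'_i$ of vertices of $V'$ joined by paths (ignoring directions) with vertices in $V'$ and arcs in $E'$, together with the arcs $E'_i$ of $E'$ having an endpoint in $V'_i$; it is all-regular if $|V'_i|=|E'_i|$ for all $i$. A unicyclic component is a component whose arcs have both ends in $V'_i$ and whose underlying graph is connected with exactly one cycle. For a cycle of length $k$, traverse it in the direction for which the number $g$ of arcs oriented against the traversal (negative arcs) satisfies $0\le g\le\lfloor k/2\rfloor$. A unicyclic component with cycle length $k$ and $g$ negative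 arcs is $p$-vanishing if $p\mid k-2g$ and non-$p$-vanishing otherwise. *)

(* Defs.v *)
From mathcomp Require Import all_boot all_order all_algebra.
From mathcomp Require Import complex.
From mathcomp Require Import boolp reals trigo.
Set Implicit Arguments.
Unset Strict Implicit.
Unset Printing Implicit Defensive.
Import GRing.Theory Num.Theory.
Local Open Scope ring_scope.
Local Open Scope complex_scope.

(* An oriented graph on the finite vertex type V: arcs are ordered pairs (u,v)
   meaning u -> v; no loops, no pair of opposite arcs (multiple arcs are
   impossible for a set of pairs). *)
Definition oriented_graph (V : finType) (E : {set V * V}) : Prop :=
  forall u v : V, (u, v) \in E -> u != v /\ (v, u) \notin E.

Definition omega (R : realType) (p q : nat) : R[i] :=
  (cos (2 * pi * q%:R / p%:R))%:C + 'i * (sin (2 * pi * q%:R / p%:R))%:C.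

Definition hlap (R : realType) (V : finType) (w : R[i])
    (V' : {set V}) (E' : {set V * V}) : 'M[R[i]]_#|V'| :=
  \matrix_(i, j)
    (let u := enum_val i in let v := enum_val j in
     if u == v then (#|[set e in E' | (e.1 == u) || (e.2 == u)]|)%:R
     else if (u, v) \in E' then - w
     else if (v, u) \in E' then - w^*
     else 0).

Definition sadj (V : finType) (V' : {set V}) (E' : {set V * V}) : rel V :=
  fun u v => [&& u \in V', v \in V' & ((u, v) \in E') || ((v, u) \in E')].

Definition comp_of (V : finType) (V' : {set V}) (E' : {set V * V}) (u : V)
  : {set V} := [set v in V' | connect (sadj V' E') u v].

Definition components (V : finType) (V' : {set V}) (E' : {set V * V})
  : {set {set V}} := [set comp_of V' E' u | u in V'].

Definition comp_arcs (V : finType) (E' : {set V * V}) (C : {set V})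
  : {set V * V} := [set e in E' | (e.1 \in C) || (e.2 \in C)].

Definition all_regular (V : finType) (V' : {set V}) (E' : {set V * V}) : Prop :=
  forall C, C \in components V' E' -> #|C| = #|comp_arcs E' C|.

Definition is_cycle (V : finType) (E' : {set V * V}) (C : {set V})
    (s : seq V) : Prop :=
  [/\ uniq s, (3 <= size s)%N, all (fun x => x \in C) s &
      cycle (fun x y => ((x, y) \in comp_arcs E' C) || ((y, x) \in comp_arcs E' C)) s].

Definition cycle_arcs (V : finType) (E' : {set V * V}) (s : seq V)
  : {set V * V} :=
  [set e in E' | ((e.1 \in s) && (e.2 == next s e.1))
              || ((e.2 \in s) && (e.1 == next s e.2))].

Definition neg_arcs (V : finType) (E' : {set V * V}) (s : seq V) : nat :=
  count (fun x => (next s x, x) \in E') s.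

(* C is (the vertex class of) a unicyclic component: all its arcs have both
   ends in C, and its underlying graph (connected, as C is a component) has
   exactly one cycle (all cycle traversals have the same arc set). *)
Definition unicyclic (V : finType) (V' : {set V}) (E' : {set V * V})
    (C : {set V}) : Prop :=
  [/\ C \in components V' E',
      (forall e, e \in comp_arcs E' C -> e.1 \in C /\ e.2 \in C) &
      exists s, is_cycle E' C s /\
        forall t, is_cycle E' C t -> cycle_arcs E' t = cycle_arcs E' s].

(* p-vanishing: with k the cycle length and g the number of negative arcs in
   the traversal direction for which 0 <= g <= k/2, p divides k - 2g. *)
Definition p_vanishing (p : nat) (V : finType) (V' : {set V})
    (E' : {set V * V}) (C : {set V}) : Prop :=
  unicyclic V' E' C /\
  exists s, is_cycle E' C s /\
    (let k := size s in let g := minn (neg_arcs E' s) (k - neg_arcs E' s) in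
     (p %| k - 2 * g)%N).

Definition n_unicyclic (V : finType) (V' : {set V}) (E' : {set V * V}) : nat :=
  #|[set C in components V' E' | `[< unicyclic V' E' C >]]|.

(* Main.v *)
Require Import Defs.
From mathcomp Require Import all_boot all_order all_algebra.
From mathcomp Require Import complex.
From mathcomp Require Import boolp reals trigo.
From mathcomp Require Import perm zify.
Set Implicit Arguments.
Unset Strict Implicit.
Unset Printing Implicit Defensive.
Import Order.TTheory GRing.Theory Num.Theory.
Local Open Scope ring_scope.

(* The Laplacian is block diagonal along the components. An all-regular
   component C has as many arcs as vertices, so either one arc leaves C and the
   others form a spanning tree, or C is a spanning tree plus one arc. In both
   cases the vertices of C can be matched bijectively with incident arcs: v with
   an arc phi v joining v to f v, where f moves towards the root a of the tree
   and f a is the other end of the remaining arc. With columns labelled through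
   phi, the incidence matrix B satisfies L = B B^* and is triangular up to its
   column a. Hence det L = 1 if f a lies outside C. Otherwise the orbit of a
   under f is the unique cycle of C and det L = |1 - c|^2, c being the product of
   the weights along this cycle, i.e. det L = (1 - w^m)(1 - w^-m) with
   m = k - 2g. If p does not divide m, the product of these numbers over
   q = 1, ..., (p-1)/2 is the product of the 1 - z^i, 0 < i < p, for a primitive
   p-th root of unity z, which equals p. *)

(** * Determinants of matrices indexed by a finite type *)

Section FunctionMatrices.
Variables (V : finType) (F : comNzRingType).
Implicit Types (f g : V -> V -> F) (A B C : {set V}).

Definition fun_mx f : 'M[F]_#|V| := \matrix_(i, j) f (enum_val i) (enum_val j).

(** Padding a block with the identity keeps blocks of all sizes in one matrix ring indexed by [V],
    so a block-diagonal matrix becomes a product of padded blocks. *)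
Definition ext_id A f (u v : V) : F :=
  if (u \in A) && (v \in A) then f u v else (u == v)%:R.

Lemma eq_fun_mx f g : f =2 g -> fun_mx f = fun_mx g.
Proof. by move=> fg; apply/matrixP=> i j; rewrite !mxE. Qed.

Lemma mul_fun_mx f g :
  fun_mx f *m fun_mx g = fun_mx (fun u v => \sum_w f u w * g w v).
Proof.
apply/matrixP=> i j; rewrite !mxE (reindex (@enum_val V predT)) /=; last first.
  by apply: onW_bij; exact: enum_val_bij.
by apply: eq_bigr => k _; rewrite !mxE.
Qed.

Lemma ext_idU A B f : [disjoint A & B] ->
  {in A & B, forall u v, f u v = 0} -> {in B & A, forall u v, f u v = 0} ->
  fun_mx (ext_id (A :|: B) f) = fun_mx (ext_id A f) *m fun_mx (ext_id B f).
Proof.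
move=> dAB fAB fBA; rewrite mul_fun_mx; apply: eq_fun_mx => u v.
have nB x : x \in A -> x \in B = false.
  by move=> xA; exact: (disjointFr dAB xA).
rewrite /ext_id !inE.
case uA: (u \in A) => /=; last first.
  rewrite (bigD1 u) //= eqxx mul1r big1 ?addr0 => [|w wu]; last first.
    by rewrite eq_sym (negbTE wu) mul0r.
  case uB: (u \in B) => //=.
  case vA: (v \in A) => //=; rewrite (nB _ vA) fBA //.
  by case: eqP => // uv; rewrite uv vA in uA.
case vB: (v \in B); last first.
  rewrite orbF (bigD1 v) //= andbF eqxx mulr1 big1 ?addr0 // => w wv.
  by rewrite andbF (negbTE wv) mulr0.
have vA : v \in A = false by rewrite (disjointFl dAB vB).
rewrite orbT fAB // big1 // => w _.
case wA: (w \in A) => /=; last first.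
  case: (u =P w) => [uw|_]; last by rewrite mul0r.
  by rewrite uw wA in uA.
rewrite (nB _ wA) /=; case: eqP => [wv|_]; last by rewrite mulr0.
by rewrite wv vA in wA.
Qed.

Lemma ext_id0 f : fun_mx (ext_id set0 f) = 1%:M.
Proof.
by apply/matrixP=> i j; rewrite !mxE /ext_id inE /= (inj_eq enum_val_inj).
Qed.

Lemma det_ext_id_bigcup (cs : seq {set V}) f :
  uniq cs -> {in cs &, forall A B, A != B -> [disjoint A & B]} ->
  {in cs &, forall A B, A != B -> {in A & B, forall u v, f u v = 0}} ->
  \det (fun_mx (ext_id (\bigcup_(C <- cs) C) f))
    = \prod_(C <- cs) \det (fun_mx (ext_id C f)).
Proof.
elim: cs => [|A cs IH] /=.
  by move=> _ _ _; rewrite !big_nil ext_id0 det1.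
move=> /andP[Acs ucs] dis f0; rewrite !big_cons ext_idU ?det_mulmx ?IH //.
- by move=> B D Bcs Dcs; apply: dis; rewrite inE ?Bcs ?Dcs orbT.
- by move=> B D Bcs Dcs; apply: f0; rewrite inE ?Bcs ?Dcs orbT.
- rewrite bigcup_seq; apply/bigcup_disjointP => B Bcs.
  apply: (dis A B); rewrite ?inE ?eqxx ?Bcs ?orbT //.
  by apply: contraNneq Acs => ->.
- move=> u v uA; rewrite bigcup_seq => /bigcupP[B Bcs vB].
  apply: (f0 A B); rewrite ?inE ?eqxx ?Bcs ?orbT //.
  by apply: contraNneq Acs => ->.
- move=> u v; rewrite bigcup_seq => /bigcupP[B Bcs uB] vA.
  apply: (f0 B A); rewrite ?inE ?eqxx ?Bcs ?orbT //.
  by apply: contraNneq Acs => <-.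
Qed.

(** Two enumerations of [V] differ by one permutation acting on rows and columns alike, so its sign
    enters squared. The free [n] admits sizes such as [#|A| + #|~: A|]. *)
Lemma det_fun_mx_reindex n (h : 'I_n -> V) f : n = #|V| -> injective h ->
  \det (\matrix_(i < n, j < n) f (h i) (h j)) = \det (fun_mx f).
Proof.
move=> nV; move: h; rewrite {n}nV => h hinj.
have sinj : injective (fun i : 'I_#|V| => enum_rank (h i)).
  by move=> i j /enum_rank_inj/hinj.
pose s := perm sinj.
have -> : (\matrix_(i, j) f (h i) (h j)) = row_perm s (col_perm s (fun_mx f)).
  by apply/matrixP=> i j; rewrite !mxE !permE !enum_rankK.
rewrite row_permE col_permE !det_mulmx !det_perm odd_permV mulrCA -expr2.
by rewrite sqrr_sign mulr1.
Qed.

(** With the vertices of [A] listed first, the padded matrix is block lower triangular and its lower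
    right block is an identity. *)
Lemma det_sub_ext_id A f :
  \det (\matrix_(i < #|A|, j < #|A|) f (enum_val i) (enum_val j))
    = \det (fun_mx (ext_id A f)).
Proof.
pose h (i : 'I_(#|A| + #|~: A|)) : V :=
  match split i with inl j => enum_val j | inr j => enum_val j end.
have hl i : h (lshift _ i) = enum_val i by rewrite /h (unsplitK (inl i)).
have hr i : h (rshift _ i) = enum_val i by rewrite /h (unsplitK (inr i)).
have inl' (i : 'I_#|A|) : enum_val i \in A by exact: enum_valP.
have inr' (i : 'I_#|~: A|) : (enum_val i \in A) = false.
  by have := enum_valP i; rewrite inE => /negbTE.
have hinj : injective h.
  move=> i j; rewrite -(splitK i) -(splitK j).
  case: (split i) (split j) => [i'|i'] [j'|j'] /=; rewrite ?hl ?hr.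
  - by move/enum_val_inj->.
  - by move=> e; have := inl' i'; rewrite e inr'.
  - by move=> e; have := inl' j'; rewrite -e inr'.
  - by move/enum_val_inj->.
rewrite -(@det_fun_mx_reindex _ h) ?cardsC //.
set M := (X in _ = \det X).
rewrite -(submxK M).
have -> : ursubmx M = 0.
  apply/matrixP=> i j; rewrite !mxE hl hr /ext_id inl' inr' /=.
  by case: eqP => // e; have := inl' i; rewrite e inr'.
have -> : drsubmx M = 1%:M.
  by apply/matrixP=> i j; rewrite !mxE !hr /ext_id !inr' (inj_eq enum_val_inj).
rewrite det_lblock det1 mulr1; congr (\det _).
by apply/matrixP=> i j; rewrite !mxE !hl /ext_id !inl'.
Qed.

(* In the Leibniz formula a permutation s contributes only if d u <= d (s u)
   for all u, with strict inequality when s u != u; summing over u forces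
   s = 1. *)
Lemma det_ranked f (d : V -> nat) :
  (forall u v, u != v -> f u v != 0 -> (d u < d v)%N) ->
  \det (fun_mx f) = \prod_u f u u.
Proof.
move=> fd; rewrite /determinant (bigD1 (1%g : {perm 'I_#|V|})) //= odd_perm1 expr0 mul1r.
rewrite [X in _ + X]big1 ?addr0 => [|s s1].
  rewrite [RHS](reindex (@enum_val V predT)) /=; last first.
    by apply: onW_bij; exact: enum_val_bij.
  by apply: eq_bigr => i _; rewrite mxE perm1.
apply/eqP; rewrite mulrI_eq0; last by apply: lregX; exact/lregN/lreg1.
case: (boolP [exists i, f (enum_val i) (enum_val (s i)) == 0]) => [/existsP[i /eqP e]|].
  by rewrite (bigD1 i) //= mxE e mul0r.
rewrite negb_exists => /forallP nz.
case/eqP: s1; apply/permP => i; rewrite perm1; apply/eqP; apply/negPn/negP => si.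
pose D (j : 'I_#|V|) := d (enum_val j).
have Dle j : (D j <= D (s j))%N.
  have [->//|sj] := eqVneq (s j) j.
  by apply/ltnW/fd => //; rewrite (inj_eq enum_val_inj) eq_sym.
have : (\sum_j D j < \sum_j D (s j))%N.
  rewrite (bigD1 i) //= [X in (_ < X)%N](bigD1 i) //= -addSn leq_add //.
    by apply: fd => //; rewrite (inj_eq enum_val_inj) eq_sym.
  exact: leq_sum.
by rewrite [X in (X < _)%N](reindex_inj (@perm_inj _ s)) ltnn.
Qed.

End FunctionMatrices.

(** * Components and their rooted structure *)

Section BreadthFirst.
Variables (V : finType) (e : rel V) (r : V).

(** [d] is the distance to [r], and [t v] is a neighbour at smaller distance; the second vertex of a
    shortest path shows that one exists. *)
Lemma rank_to_root : exists (t : V -> V) (d : V -> nat),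
  forall v, connect e v r -> v != r -> e v (t v) /\ (d (t v) < d v)%N.
Proof.
pose P v n := `[< exists p, [/\ path e v p, last v p = r & size p = n] >].
have [d dP] : {d : V -> nat & forall v, connect e v r ->
    P v (d v) /\ forall n, P v n -> (d v <= n)%N}.
  apply: (@choice _ _ (fun v n => connect e v r ->
    P v n /\ forall m, P v m -> (n <= m)%N)) => v.
  case: (boolP (connect e v r)) => [/connectP[p pp lp]|_]; last by exists 0%N.
  have exP : exists n, P v n by exists (size p); apply/asboolP; exists p.
  by exists (ex_minn exP) => _; case: ex_minnP => m Pm mmin; split.
exists (fun v => odflt v [pick y | e v y && (d y < d v)%N]), d => v vr v_r.
case: pickP => [y /andP[]//|no] /=.
have [/asboolP[p [pp lp sp]] _] := dP v vr.
case: p pp lp sp => [_ /= vr'|y p /= /andP[ey pp] lp sp].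
  by rewrite vr' eqxx in v_r.
have yr : connect e y r by apply/connectP; exists p.
have [_ ymin] := dP y yr.
have := no y; rewrite ey -sp ltnS ymin //.
by apply/asboolP; exists p.
Qed.

End BreadthFirst.

(** * Components and the matching of their vertices with arcs *)

Section Components.
Variables (V : finType) (V' : {set V}) (E' : {set V * V}).
Implicit Types (A : {set V * V}) (C D : {set V}) (u v : V).

Definition joined A : rel V := fun u v => ((u, v) \in A) || ((v, u) \in A).

Definition link C A : rel V := fun u v => [&& u \in C, v \in C & joined A u v].

Definition arc_of A u v := if (u, v) \in A then (u, v) else (v, u).

Lemma joinedC A u v : joined A u v = joined A v u.
Proof. by rewrite /joined orbC. Qed.

Lemma arc_ofP A u v : joined A u v -> arc_of A u v \in A.
Proof. by rewrite /joined /arc_of; case: ifP. Qed.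

Lemma arc_of_cases A u v : arc_of A u v = (u, v) \/ arc_of A u v = (v, u).
Proof. by rewrite /arc_of; case: ifP; [left | right]. Qed.

Lemma arc_of_eq A u v u' v' :
  arc_of A u v = arc_of A u' v' -> u != u' -> u = v' /\ v = u'.
Proof.
case: (arc_of_cases A u v) (arc_of_cases A u' v') => -> [] -> [-> ->] //;
by rewrite eqxx.
Qed.

Lemma link_connectC C A : connect_sym (link C A).
Proof.
by apply: sym_connect_sym => u v; rewrite /link joinedC; case: (u \in C);
  case: (v \in C).
Qed.

Lemma sadj_connectC : connect_sym (sadj V' E').
Proof. exact: (link_connectC V' E'). Qed.

Lemma component_sub C : C \in components V' E' -> C \subset V'.
Proof.
by case/imsetP=> u uV ->; apply/subsetP => v; rewrite inE => /andP[].
Qed.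

Lemma comp_of_eq C u : C \in components V' E' -> u \in C -> C = comp_of V' E' u.
Proof.
case/imsetP=> w wV ->; rewrite inE => /andP[_ wu].
by apply/setP=> v; rewrite !inE (same_connect sadj_connectC wu).
Qed.

Lemma component_neq0 C : C \in components V' E' -> exists u, u \in C.
Proof. by case/imsetP=> u uV ->; exists u; rewrite inE uV connect0. Qed.

Lemma component_closed C u v : C \in components V' E' ->
  u \in C -> v \in V' -> joined E' u v -> v \in C.
Proof.
move=> Cc uC vV uv; rewrite (comp_of_eq Cc uC) inE vV connect1 //.
by rewrite /sadj (subsetP (component_sub Cc)) // vV.
Qed.

Lemma components_disjoint C D : C \in components V' E' ->
  D \in components V' E' -> C != D -> [disjoint C & D].
Proof.
move=> Cc Dc; apply: contraR => /pred0Pn[u /andP[/= uC uD]].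
by rewrite (comp_of_eq Cc uC) (comp_of_eq Dc uD).
Qed.

Lemma bigcup_components : \bigcup_(C <- enum (components V' E')) C = V'.
Proof.
rewrite big_enum; apply/setP => u; apply/bigcupP/idP => [[C Cc uC]|uV].
  exact: (subsetP (component_sub Cc)).
by exists (comp_of V' E' u); [exact: imset_f | rewrite inE uV connect0].
Qed.

(** A path of the substructure that starts in [C] stays in [C], so all its steps use arcs of the
    component. In this form one arc can be removed. *)
Lemma component_linked C u v : C \in components V' E' ->
  u \in C -> v \in C -> connect (link C (comp_arcs E' C)) u v.
Proof.
move=> Cc uC; rewrite {1}(comp_of_eq Cc uC) inE => /andP[_ /connectP[p pp ->]].
elim: p u uC pp => [|w p IH] u uC /=; first by rewrite connect0.
case/andP=> /and3P[uV wV uw] pp.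
have wC := component_closed Cc uC wV uw.
apply: connect_trans (IH w wC pp); apply: connect1.
by rewrite /link uC wC /joined !inE /= uC wC ?orbT !andbT.
Qed.

(* phi pairs every vertex v of C with an incident arc joining v to f v, and
   every f-trajectory in C reaches a. *)
Definition rooted C (a : V) (f : V -> V) (phi : V -> V * V) (d : V -> nat) :=
  [/\ {in C &, injective phi}, phi @: C = comp_arcs E' C, a \in C,
      {in C, forall v, phi v = (v, f v) \/ phi v = (f v, v)} &
      {in C, forall v, v != a -> f v \in C /\ (d (f v) < d v)%N}].

(** [phi] sends [a] to [e0] and any other [v] to the arc towards its parent [t v]. Two vertices
    sharing a tree arc would be each other's parent, against the decreasing rank; surjectivity then
    follows by counting. *)
Lemma rooted_of_arc C a o e0 : #|C| = #|comp_arcs E' C| ->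
  e0 \in comp_arcs E' C -> a \in C -> e0 = (a, o) \/ e0 = (o, a) ->
  {in C, forall v, connect (link C (comp_arcs E' C :\ e0)) v a} ->
  exists f phi d, rooted C a f phi d.
Proof.
set A := _ :\ e0 => cardC e0C aC e0a conn.
have [t [d td]] := rank_to_root (link C A) a.
pose f v := if v == a then o else t v.
pose phi v := if v == a then e0 else arc_of A v (t v).
have phiA v : v \in C -> v != a -> phi v \in A.
  move=> vC va; rewrite /phi (negbTE va); apply: arc_ofP.
  by have [/and3P[]] := td v (conn v vC) va.
have phi_inj : {in C &, injective phi}.
  move=> u v uC vC.
  have e0A : e0 \notin A by rewrite !inE eqxx.
  have [->|ua] := eqVneq u a; have [->|va] := eqVneq v a => //.
  - by move=> e; have := phiA v vC va; rewrite -e /phi eqxx (negbTE e0A).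
  - by move=> e; have := phiA u uC ua; rewrite e /phi eqxx (negbTE e0A).
  rewrite /phi (negbTE ua) (negbTE va) => e; apply/eqP/negPn/negP => uv.
  have [e1 e2] := arc_of_eq e uv.
  have [_ d1] := td u (conn u uC) ua; have [_ d2] := td v (conn v vC) va.
  by move: d1; rewrite e2 e1 => /(ltn_trans d2); rewrite ltnn.
exists f, phi, d; split=> // [|v vC|v vC va].
- apply/eqP; rewrite eqEcard card_in_imset // cardC leqnn andbT.
  apply/subsetP => _ /imsetP[v vC ->].
  have [->|va] := eqVneq v a; first by rewrite /phi eqxx.
  by have := phiA v vC va; rewrite inE => /andP[].
- rewrite /phi /f; case: eqP => [->|_]; first exact: e0a.
  exact: arc_of_cases.
- rewrite /f (negbTE va).
  by have [/and3P[]] := td v (conn v vC) va.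
Qed.

(** It suffices to find an arc whose removal keeps [C] connected: an arc leaving [C], or else an arc
    outside a spanning tree. *)
Lemma comp_rooted C : C \in components V' E' -> #|C| = #|comp_arcs E' C| ->
  exists a f phi d, rooted C a f phi d.
Proof.
move=> Cc cardC.
suff [e0 [a [o [e0C aC e0a conn]]]] : exists e0 a o,
    [/\ e0 \in comp_arcs E' C, a \in C, e0 = (a, o) \/ e0 = (o, a) &
        {in C, forall v, connect (link C (comp_arcs E' C :\ e0)) v a}].
  by exists a; apply: (rooted_of_arc cardC e0C aC e0a conn).
case: (boolP [exists e in comp_arcs E' C, (e.1 \notin C) || (e.2 \notin C)]).
  case/existsP=> e0 /andP[e0C e0out].
  have conn u v : u \in C -> v \in C ->
      connect (link C (comp_arcs E' C :\ e0)) u v.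
    (* [e0] has an end outside [C], so it links no two vertices of [C] and its removal changes no
       link. *)
    move=> uC vC; rewrite -(eq_connect (e := link C (comp_arcs E' C))).
      exact: component_linked.
    move=> x y; rewrite /link; case xC: (x \in C); case yC: (y \in C) => //=.
    have ne x' y' : x' \in C -> y' \in C -> ((x', y') != e0).
      move=> x'C y'C; apply: contraL e0out => /eqP <- /=.
      by rewrite x'C y'C.
    by rewrite /joined !(in_setD1 (_, _)) !ne.
  move: (e0C); rewrite inE => /andP[_] /orP[aC|aC].
    exists e0, e0.1, e0.2; split=> // [|v vC]; last exact: conn.
    by left; case: (e0).
  exists e0, e0.2, e0.1; split=> // [|v vC]; last exact: conn.
  by right; case: (e0).
rewrite negb_exists => /forallP int.
have intC e : e \in comp_arcs E' C -> e.1 \in C /\ e.2 \in C.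
  move=> eC; have := int e; rewrite eC /= negb_or !negbK.
  by case/andP.
have [r rC] := component_neq0 Cc.
have [t [d td]] := rank_to_root (link C (comp_arcs E' C)) r.
have cr v : v \in C -> connect (link C (comp_arcs E' C)) v r.
  by move=> vC; apply: component_linked.
pose tau v := arc_of (comp_arcs E' C) v (t v).
(* There are at most [#|C| - 1] tree arcs but [#|C|] arcs in the component. *)
have /subsetPn[e0 e0C e0tau] :
    ~~ (comp_arcs E' C \subset tau @: (C :\ r)).
  apply/negP => /subset_leq_card; rewrite -cardC => /leq_trans/(_ (leq_imset_card _ _)).
  by rewrite [X in (X <= _)%N](cardsD1 r) rC ltnn.
exists e0, e0.1, e0.2; have [e01 e02] := intC e0 e0C.
split=> //; first by left; case: (e0).
set A := _ :\ e0.
suff conn v : v \in C -> connect (link C A) v r.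
  move=> v vC; apply: connect_trans (conn v vC) _.
  by rewrite link_connectC conn.
(* Tree paths to [r] avoid [e0]; induction on the rank [d v]. *)
have [n] := ubnP (d v); elim: n v => // n IH v; rewrite ltnS => dv vC.
have [->|vr] := eqVneq v r; first exact: connect0.
have [/and3P[_ tvC vtv] dtv] := td v (cr v vC) vr.
apply: connect_trans (IH (t v) (leq_trans dtv dv) tvC); apply: connect1.
rewrite /link vC tvC /=.
have : tau v \in A.
  rewrite !inE; apply/andP; split; last by have := arc_ofP vtv; rewrite inE.
  by apply: contraNneq e0tau => <-; apply: imset_f; rewrite !inE vr.
by rewrite /tau /joined; case: (arc_of_cases (comp_arcs E' C) v (t v)) => ->;
  move=> ->; rewrite ?orbT.
Qed.
Lemma cycle_arcs_rev (t : seq V) : uniq t ->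
  cycle_arcs E' (rev t) = cycle_arcs E' t.
Proof.
move=> ut; apply/setP => -[x y]; rewrite !inE /= !mem_rev !next_rev //.
congr (_ && _); rewrite orbC.
have sw (z w : V) : (z \in t) && (w == prev t z) = (w \in t) && (z == next t w).
  apply/andP/andP => [[zt /eqP->]|[wt /eqP->]].
    by rewrite mem_prev next_prev.
  by rewrite mem_next prev_next.
by rewrite !sw.
Qed.

Hypothesis ori : oriented_graph E'.

(** * The cycle of a rooted component *)

Section Rooted.
Variables (C : {set V}) (a : V) (f : V -> V) (phi : V -> V * V) (d : V -> nat).
Hypothesis rootedC : rooted C a f phi d.

Let phi_inj : {in C &, injective phi}. Proof. by case: rootedC. Qed.
Let phi_im : phi @: C = comp_arcs E' C. Proof. by case: rootedC. Qed.
Let aC : a \in C. Proof. by case: rootedC. Qed.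
Let phiP : {in C, forall v, phi v = (v, f v) \/ phi v = (f v, v)}.
Proof. by case: rootedC. Qed.
Let f_rank : {in C, forall v, v != a -> f v \in C /\ (d (f v) < d v)%N}.
Proof. by case: rootedC. Qed.

Lemma phi_comp_arcs v : v \in C -> phi v \in comp_arcs E' C.
Proof. by move=> vC; rewrite -phi_im imset_f. Qed.

Lemma phi_arc v : v \in C -> phi v \in E'.
Proof. by move=> /phi_comp_arcs; rewrite inE => /andP[]. Qed.

Lemma rooted_f_neq v : v \in C -> f v != v.
Proof.
move=> vC; apply/eqP => fv; have := phi_arc vC.
by case: (phiP vC) => ->; rewrite fv => /ori[]; rewrite eqxx.
Qed.

(** Otherwise [phi v] and [phi (f v)] would be distinct arcs between the same two vertices, hence
    opposite. *)
Lemma rooted_f2_neq v : v \in C -> f v \in C -> f (f v) != v.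
Proof.
move=> vC fvC; apply/eqP => ffv.
have := phi_arc vC; have := phi_arc fvC.
have : phi v != phi (f v).
  by rewrite (inj_in_eq phi_inj) // eq_sym rooted_f_neq.
by case: (phiP vC) (phiP fvC) => -> [] ->; rewrite ffv ?eqxx // => _ h /ori[_];
  rewrite h.
Qed.

Lemma rooted_joined u v : u \in C -> v \in C -> joined (comp_arcs E' C) u v ->
  f u = v \/ f v = u.
Proof.
move=> uC vC; rewrite /joined -phi_im.
by case/orP=> /imsetP[w wC]; case: (phiP wC) => -> [-> ->]; auto.
Qed.

Lemma rooted_external_not_unicyclic : f a \notin C -> ~ unicyclic V' E' C.
Proof.
move=> faC [_ /(_ _ (phi_comp_arcs aC))] int _; move: int.
by case: (phiP aC) => -> /= [] h1 h2; rewrite ?h1 ?h2 in faC.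
Qed.

Hypothesis faC : f a \in C.

Lemma rooted_f_in v : v \in C -> f v \in C.
Proof.
by move=> vC; have [->//|va] := eqVneq v a; have [] := f_rank vC va.
Qed.

Lemma rooted_fconnect v : v \in C -> fconnect f v a.
Proof.
have [n] := ubnP (d v); elim: n v => // n IH v; rewrite ltnS => dv vC.
have [->|va] := eqVneq v a; first exact: connect0.
have [fvC dfv] := f_rank vC va.
exact: connect_trans (fconnect1 f v) (IH _ (leq_trans dfv dv) fvC).
Qed.

(** Every trajectory in [C] reaches [a], in particular the one from [f a], so the orbit of [a]
    closes up. *)
Lemma rooted_orbit_cycle : fcycle f (orbit f a).
Proof. by apply/(orbitPcycle 2 0); exact: rooted_fconnect. Qed.

Lemma rooted_iter_in k v : v \in C -> iter k f v \in C.
Proof. by move=> vC; elim: k => //= k; apply: rooted_f_in. Qed.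

Lemma rooted_orbit_sub x : x \in orbit f a -> x \in C.
Proof. by case/trajectP=> k _ ->; exact: rooted_iter_in. Qed.

Lemma rooted_next_orbit x : x \in orbit f a -> next (orbit f a) x = f x.
Proof. by move=> xo; have /eqP := next_cycle rooted_orbit_cycle xo. Qed.

Lemma rooted_joined_f v : v \in C -> joined (comp_arcs E' C) v (f v).
Proof.
move=> vC; have := phi_comp_arcs vC.
by rewrite /joined; case: (phiP vC) => -> ->; rewrite ?orbT.
Qed.

Lemma rooted_is_cycle : is_cycle E' C (orbit f a).
Proof.
split.
- exact: orbit_uniq.
(* Lengths 1 and 2 are impossible: on [C], [f] has no fixed point and no 2-cycle. *)
- have := order_gt0 f a; rewrite size_orbit.
  have : iter (order f a) f a = a by apply/(orbitPcycle 0 4); exact: rooted_orbit_cycle.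
  case: (order f a) => [|[|[|n]]] //= /eqP.
    by rewrite (negbTE (rooted_f_neq aC)).
  by rewrite (negbTE (rooted_f2_neq aC faC)).
- by apply/allP => x; exact: rooted_orbit_sub.
- apply: (sub_in_cycle (P := mem C)) rooted_orbit_cycle.
    by move=> x y xC _ /eqP <-; exact: rooted_joined_f.
  by apply/allP => x; exact: rooted_orbit_sub.
Qed.

(* On each edge of a cycle t, one end is the f-image of the other; since no
   step of t is immediately reversed, the direction is the same all along t. *)
Lemma rooted_cycle_dir (t : seq V) :
  is_cycle E' C t -> fcycle f t \/ fcycle f (rev t).
Proof.
move=> [ut szt /allP tC ct].
have nextE x : x \in t -> f x = next t x \/ f (next t x) = x.
  move=> xt; apply: rooted_joined (next_cycle ct xt); apply: tC => //.
  by rewrite mem_next.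
have cn := cycle_next ut.
(* A cycle of length at least 3 never backtracks at once. *)
have next2 x : x \in t -> next t (next t x) != x.
  move=> xt; apply/eqP => nn.
  have [i t' et] := rot_to xt.
  have : next (rot i t) (next (rot i t) x) = x by rewrite !next_rot.
  have : uniq (rot i t) by rewrite rot_uniq.
  have : (2 < size (rot i t))%N by rewrite size_rot.
  rewrite {}et; case: t' => [|y [|z s]] //= _.
  rewrite !inE !negb_or eqxx -!andbA => /and5P[xy xz _ yz _].
  rewrite eq_sym (negbTE xy) eqxx => zx.
  by rewrite zx eqxx in xz.
case: (boolP (all (fun x => f x == next t x) t)) => [/allP ft|].
  left; apply: (sub_in_cycle (P := mem t)) cn.
    by move=> x y xt _ /eqP <-; exact: ft.
  by apply/allP.
case/allPn => x0 x0t nx0; right; rewrite rev_cycle.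
(* The backward direction propagates from [x0]: if [f (next t y) = y], then [f] does not send
   [next t y] to its successor, which differs from [y]. *)
have back x : x \in t -> f (next t x) = x.
  move=> xt; have : fconnect (next t) x0 x.
    by rewrite (fconnect_cycle cn x0t).
  move/iter_findex <-; elim: (findex _ _ _) => [|k IH] /=.
    by case: (nextE x0 x0t) => // e; rewrite e eqxx in nx0.
  set y := iter k _ x0 in IH *.
  have yt : y \in t by rewrite /y -(fconnect_cycle cn x0t) fconnect_iter.
  case: (nextE (next t y)) => //; first by rewrite mem_next.
  by move=> e; have := next2 y yt; rewrite -e IH eqxx.
apply: (sub_in_cycle (P := mem t)) cn.
  by move=> x y xt _ /eqP <-; apply/eqP; exact: back.
by apply/allP.
Qed.

(** An [f]-cycle inside [C] contains [a], so it has the same vertices and successors as the orbit of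
    [a]. *)
Lemma rooted_fcycle_arcs (t : seq V) : (0 < size t)%N ->
  {subset t <= C} -> fcycle f t ->
  cycle_arcs E' t = cycle_arcs E' (orbit f a).
Proof.
case: t => // x t _; set s := x :: t => sC fs.
have as_ : a \in s.
  by rewrite -(fconnect_cycle fs (mem_head x t)) rooted_fconnect // sC ?mem_head.
have mem_s y : (y \in s) = (y \in orbit f a).
  by rewrite -(fconnect_cycle fs as_) -fconnect_orbit.
have nx (y z : V) : (y \in s) && (z == next s y)
    = (y \in orbit f a) && (z == next (orbit f a) y).
  rewrite mem_s; case yo: (y \in orbit f a) => //=.
  rewrite rooted_next_orbit //; rewrite -mem_s in yo.
  by have /eqP -> := next_cycle fs yo.
by apply/setP => -[y z]; rewrite !inE /= !nx.
Qed.

(** Each cycle is an [f]-cycle in one of its two directions, and reversal does not change its arc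
    set. *)
Lemma rooted_unicyclic : C \in components V' E' -> unicyclic V' E' C.
Proof.
move=> Cc; split=> // [e|].
  rewrite -phi_im => /imsetP[v vC ->].
  by case: (phiP vC) => -> /=; split=> //; exact: rooted_f_in.
exists (orbit f a); split; first exact: rooted_is_cycle.
move=> t tcyc; have [ut szt /allP tC _] := tcyc.
have szt0 : (0 < size t)%N by exact: leq_trans szt.
case: (rooted_cycle_dir tcyc) => ft; first exact: rooted_fcycle_arcs.
rewrite -cycle_arcs_rev //; apply: rooted_fcycle_arcs => //.
  by rewrite size_rev.
by move=> x; rewrite mem_rev; exact: tC.
Qed.

End Rooted.
End Components.

(** * The determinant of a component *)

Section Laplacian.
Variables (V : finType) (E' : {set V * V}) (F : numClosedFieldType) (w : F).
Hypothesis ori : oriented_graph E'.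
Hypothesis w_unit : w * w^* = 1.

Definition lap (u v : V) : F :=
  if u == v then (#|[set e in E' | (e.1 == u) || (e.2 == u)]|)%:R
  else if (u, v) \in E' then - w
  else if (v, u) \in E' then - w^*
  else 0.

(** Weighted incidence: 1 at the tail and [- w^*] at the head, so that tail times conjugate head is
    [- w]. *)
Definition inc (u : V) (e : V * V) : F :=
  if u == e.1 then 1 else if u == e.2 then - w^* else 0.

Lemma inc_norm u e : inc u e * (inc u e)^* = ((e.1 == u) || (e.2 == u))%:R.
Proof.
rewrite /inc ![_ == u]eq_sym; case: (u == e.1) => /=; first by rewrite rmorph1 mul1r.
case: (u == e.2); last by rewrite mul0r.
by rewrite rmorphN /= conjCK mulrNN mulrC.
Qed.

Lemma inc_cross u v e : u != v -> e.1 != e.2 -> inc u e * (inc v e)^*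
  = if e == (u, v) then - w else if e == (v, u) then - w^* else 0.
Proof.
case: e => x y /= uv xy; rewrite /inc /= !xpair_eqE.
have [<-|ux] := eqVneq u x.
  rewrite ?eqxx ![_ == u]eq_sym (negbTE uv) /= [v == y]eq_sym.
  by case: (y == v); rewrite ?rmorph0 ?mulr0 // rmorphN /= conjCK mul1r.
rewrite /= [y == u]eq_sym.
have [<-|uy] := eqVneq u y; last by rewrite andbF mul0r.
rewrite andbT [v == x]eq_sym; case: (x == v); first by rewrite rmorph1 mulr1.
by rewrite [v == u]eq_sym (negbTE uv) rmorph0 mulr0.
Qed.

(** This is L = B B^* on [C]. On the diagonal each incident arc contributes 1, as [w] is unimodular;
    off it at most one arc contributes, as opposite arcs are excluded. *)
Lemma lap_sum_inc (C : {set V}) : {in C &, forall u v,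
  lap u v = \sum_(e in comp_arcs E' C) inc u e * (inc v e)^*}.
Proof.
move=> u v uC vC; rewrite /lap.
have [<-|uv] := eqVneq u v.
  under eq_bigr do rewrite inc_norm.
  rewrite -natr_sum -sum1_card; congr (_%:R).
  rewrite [RHS]big_mkcond [LHS]big_mkcond; apply: eq_bigr => e _.
  rewrite !inE; case: (e \in E') => //=.
  case: eqP => [->|_] /=; first by rewrite uC.
  case: eqP => [->|_] /=; first by rewrite uC orbT.
  by rewrite if_same.
transitivity (\sum_(e in comp_arcs E' C)
    if e == (u, v) then - w else if e == (v, u) then - w^* else 0); last first.
  apply: eq_bigr => -[x y]; rewrite inE => /andP[xy _].
  by rewrite inc_cross //; have [] := ori xy.
have uvC : ((u, v) \in comp_arcs E' C) = ((u, v) \in E').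
  by rewrite inE /= uC andbT.
have vuC : ((v, u) \in comp_arcs E' C) = ((v, u) \in E').
  by rewrite inE /= vC andbT.
case: ifP => uvE; last case: ifP => vuE.
- have [_ /negP vuE] := ori uvE.
  rewrite (bigD1 (u, v)) ?uvC //= eqxx big1 ?addr0 // => e /andP[eC /negbTE->].
  by case: eqP => // e1; case: vuE; rewrite -vuC -e1.
- rewrite (bigD1 (v, u)) ?vuC //= eqxx xpair_eqE eq_sym (negbTE uv) /=.
  rewrite big1 ?addr0 // => e /andP[eC /negbTE->].
  by case: eqP => // e1; rewrite -uvC -e1 eC in uvE.
- rewrite big1 // => e eC.
  case: eqP => [e1|_]; first by rewrite -uvC -e1 eC in uvE.
  by case: eqP => // e1; rewrite -vuC -e1 eC in vuE.
Qed.

(** * Determinant of the incidence matrix of a rooted component *)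

Section RootedDet.
Variables (C : {set V}) (a : V) (f : V -> V) (phi : V -> V * V) (d : V -> nat).
Hypothesis rootedC : rooted E' C a f phi d.

Let phi_inj : {in C &, injective phi}. Proof. by case: rootedC. Qed.
Let phi_im : phi @: C = comp_arcs E' C. Proof. by case: rootedC. Qed.
Let aC : a \in C. Proof. by case: rootedC. Qed.
Let phiP : {in C, forall v, phi v = (v, f v) \/ phi v = (f v, v)}.
Proof. by case: rootedC. Qed.
Let f_rank : {in C, forall v, v != a -> f v \in C /\ (d (f v) < d v)%N}.
Proof. by case: rootedC. Qed.
Let f_neq v : v \in C -> f v != v.
Proof. exact: (rooted_f_neq ori rootedC). Qed.

Definition inc_mx : V -> V -> F := ext_id C (fun u v => inc u (phi v)).

Lemma ext_lap_factor :
  fun_mx (ext_id C lap)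
    = fun_mx inc_mx *m fun_mx (fun u v => (inc_mx v u)^*).
Proof.
rewrite mul_fun_mx; apply: eq_fun_mx => u v; rewrite /inc_mx /ext_id.
case uC: (u \in C) => /=; last first.
  rewrite (bigD1 u) //= eqxx mul1r big1 ?addr0 => [|x xu]; last first.
    by rewrite eq_sym (negbTE xu) mul0r.
  by rewrite uC andbF rmorph_nat eq_sym.
case vC: (v \in C) => /=; last first.
  rewrite (bigD1 v) //= vC eqxx rmorph1 mulr1 big1 ?addr0 // => x xv.
  by rewrite [v == x]eq_sym (negbTE xv) rmorph0 mulr0.
rewrite (bigID (mem C)) /= [X in _ + X]big1 ?addr0 => [|x xC]; last first.
  rewrite (negbTE xC); case: eqP => [ux|_]; last by rewrite mul0r.
  by rewrite -ux uC in xC.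
rewrite (@lap_sum_inc C) // -phi_im big_imset //=.
by apply: eq_bigr => x ->.
Qed.

Lemma det_ext_lap : \det (fun_mx (ext_id C lap))
  = \det (fun_mx inc_mx) * (\det (fun_mx inc_mx))^*.
Proof.
rewrite ext_lap_factor det_mulmx; congr (_ * _).
rewrite -det_tr -det_map_mx; congr (\det _).
by apply/matrixP => i j; rewrite !mxE.
Qed.

Lemma inc_mx_diag_norm u : inc_mx u u * (inc_mx u u)^* = 1.
Proof.
rewrite /inc_mx /ext_id; case uC: (u \in C) => /=.
  by rewrite inc_norm; case: (phiP uC) => -> /=; rewrite eqxx ?orbT.
by rewrite eqxx rmorph_nat mulr1.
Qed.

Lemma inc_mx_offdiag u v : u != v -> inc_mx u v != 0 ->
  [/\ u \in C, v \in C & u = f v].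
Proof.
rewrite /inc_mx /ext_id => uv; case uC: (u \in C) => /=; last first.
  by rewrite (negbTE uv) eqxx.
case vC: (v \in C) => /=; last by rewrite (negbTE uv) eqxx.
rewrite /inc; case: (phiP vC) => -> /=; rewrite (negbTE uv).
  by have [->|_] := eqVneq u (f v); rewrite ?eqxx.
by have [->|_] := eqVneq u (f v); rewrite ?eqxx.
Qed.

(** Off-diagonal entries sit only at positions [(f v, v)] with [v != a], where [d] decreases from
    [v] to [f v]; the matrix is triangular with unimodular diagonal. *)
Lemma det_ext_lap_external : f a \notin C -> \det (fun_mx (ext_id C lap)) = 1.
Proof.
move=> faC; rewrite det_ext_lap (det_ranked (d := d)) => [|u v uv nz].
  by rewrite rmorph_prod -big_split big1 //= => u _; exact: inc_mx_diag_norm.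
have [uC vC ufv] := inc_mx_offdiag uv nz.
have va : v != a by apply: contraNneq faC => <-; rewrite -ufv.
by have [_] := f_rank vC va; rewrite ufv.
Qed.

Hypothesis faC : f a \in C.

(** Minus the ratio of the entries of column [phi v] in rows [f v] and [v], as [inc_mx_next]
    shows. *)
Definition arc_weight v : F := if phi v == (v, f v) then w^* else w.

(** The product runs from [v] up to [a], with [a] itself excluded; hence the value 1 at [a]. *)
Definition path_weight v : F :=
  \prod_(x <- traject f v (findex f v a)) arc_weight x.

Lemma path_weight_root : path_weight a = 1.
Proof. by rewrite /path_weight findex0 big_nil. Qed.

Lemma path_weight_step v : v \in C -> v != a ->
  path_weight v = arc_weight v * path_weight (f v).
Proof.
move=> vC va; rewrite /path_weight fconnect_findex ?big_cons //; last by rewrite eq_sym.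
exact: rooted_fconnect rootedC _ _.
Qed.

Lemma cycle_weight :
  arc_weight a * path_weight (f a) = \prod_(x <- orbit f a) arc_weight x.
Proof.
have fc := rooted_orbit_cycle rootedC faC.
have oE : fingraph.order f (f a) = fingraph.order f a by apply/(orbitPcycle 0 1).
have itE : iter (fingraph.order f a) f a = a by apply/(orbitPcycle 0 4).
rewrite /orbit /path_weight.
have o_gt0 := fingraph.order_gt0 f a.
(* From [f a], the orbit returns to [a] after all but one of its steps. *)
have -> : findex f (f a) a = (fingraph.order f a).-1.
  rewrite -[X in findex _ _ X]itE -[X in iter X](prednK o_gt0) iterSr.
  by rewrite findex_iter // oE prednK.
by rewrite -[in RHS](prednK o_gt0) /= big_cons.
Qed.

Lemma inc_mx_next v : v \in C ->
  inc (f v) (phi v) = - (arc_weight v * inc v (phi v)).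
Proof.
move=> vC; have fv := f_neq vC; rewrite /inc /arc_weight.
have vf : v == f v = false by rewrite eq_sym (negbTE fv).
case: (phiP vC) => ->; rewrite /= ?xpair_eqE !eqxx (negbTE fv) ?mulr1 //=.
by rewrite vf mulrN opprK w_unit.
Qed.

(* Replacing row a of the identity by the path weights y gives a matrix of
   determinant 1; y annihilates every column of inc_mx except column a. *)
Lemma det_inc_mx : \det (fun_mx inc_mx)
  = (1 - \prod_(x <- orbit f a) arc_weight x) * \prod_u inc_mx u u.
Proof.
pose Q u v : F :=
  if u == a then (if v \in C then path_weight v else 0) else (u == v)%:R.
have detQ : \det (fun_mx Q) = 1.
  rewrite (det_ranked (d := fun u => (u != a) : nat)) => [|u v uv].
    apply: big1 => u _; rewrite /Q; case: eqP => [->|_]; last by rewrite eqxx.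
    by rewrite aC path_weight_root.
  rewrite /Q; have [ua|_] := eqVneq u a; last by rewrite (negbTE uv) eqxx.
  by rewrite -ua [v == u]eq_sym uv.
pose c := \prod_(x <- orbit f a) arc_weight x.
pose M u v : F := if u == a then (if v == a then (1 - c) * inc_mx a a else 0)
  else inc_mx u v.
have QB : fun_mx Q *m fun_mx inc_mx = fun_mx M.
  rewrite mul_fun_mx; apply: eq_fun_mx => u v; rewrite /Q /M.
  have [_|ua] := eqVneq u a; last first.
    rewrite (bigD1 u) //= eqxx mul1r big1 ?addr0 // => x xu.
    by rewrite eq_sym (negbTE xu) mul0r.
  have [vC|vC] := boolP (v \in C); last first.
    have -> : v == a = false by apply: contraNF vC => /eqP ->.
    rewrite big1 // => x _; case: ifP => xC; last by rewrite mul0r.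
    rewrite /inc_mx /ext_id (negbTE vC) andbF; case: eqP => [xv|_].
      by rewrite -xv xC in vC.
    by rewrite mulr0.
  have fvC := rooted_f_in rootedC faC vC.
  (* Column [v] can be non-zero only in rows [v] and [f v]. *)
  rewrite (bigD1 v) //= (bigD1 (f v)) ?f_neq //= big1 ?addr0; last first.
    move=> x /andP[xv xfv].
    have [->|nz] := eqVneq (inc_mx x v) 0; first by rewrite mulr0.
    by have [_ _ xe] := inc_mx_offdiag xv nz; rewrite xe eqxx in xfv.
  rewrite vC fvC /inc_mx /ext_id vC fvC aC /= inc_mx_next //.
  rewrite mulrN mulrA [path_weight (f v) * _]mulrC -mulrBl.
  have [->|va] := eqVneq v a; first by rewrite path_weight_root cycle_weight.
  by rewrite path_weight_step // subrr mul0r.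
have <- : \det (fun_mx M) = \det (fun_mx inc_mx).
  by rewrite -QB det_mulmx detQ mul1r.
(* Row [a] is now zero off the diagonal, so [a] may be given a rank above all values of [d]; this
   also handles the entry of column [a] in row [f a]. *)
rewrite (det_ranked (d := fun v => if v == a then (\sum_x d x).+1 else d v)).
  rewrite (bigD1 a) //= [\prod_u inc_mx u u](bigD1 a) //= mulrA /M eqxx; congr (_ * _).
  by apply: eq_bigr => u /negbTE ->.
move=> u v uv; rewrite /M; have [ua|ua] := eqVneq u a.
  by rewrite -ua [v == u]eq_sym (negbTE uv) eqxx.
move=> nz; have [uC vC ufv] := inc_mx_offdiag uv nz.
have [va|va] := eqVneq v a.
  by rewrite ltnS (bigD1 u) //= leq_addr.
by have [_] := f_rank vC va; rewrite ufv.
Qed.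

Lemma det_ext_lap_cycle (c := \prod_(x <- orbit f a) arc_weight x) :
  \det (fun_mx (ext_id C lap)) = (1 - c) * (1 - c)^*.
Proof.
rewrite det_ext_lap det_inc_mx rmorphM /= mulrACA rmorph_prod -big_split.
by rewrite [X in _ * X]big1 ?mulr1 //= => u _; exact: inc_mx_diag_norm.
Qed.

(** Along the orbit, an arc followed forwards contributes [w^*] and a negative arc contributes
    [w]. *)
Lemma cycle_weight_neg_arcs (s := orbit f a) (g := neg_arcs E' s) :
  \prod_(x <- s) arc_weight x = w ^+ g * w^* ^+ (size s - g).
Proof.
have sE x : x \in s -> ((next s x, x) \in E') = (phi x != (x, f x)).
  move=> xs; have xC := rooted_orbit_sub rootedC faC xs.
  rewrite (rooted_next_orbit rootedC faC xs).
  have := phi_arc rootedC xC; case: (phiP xC) => ->.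
    by rewrite eqxx /= => /ori[_ /negbTE].
  by move=> ->; rewrite xpair_eqE (negbTE (f_neq xC)).
have gE : g = count (fun x => phi x != (x, f x)) s.
  by apply: eq_in_count => x; exact: sE.
have kE : (size s - g)%N = count (fun x => phi x == (x, f x)) s.
  rewrite -(count_predC (fun x => phi x != (x, f x)) s) -gE addKn.
  by apply: eq_count => x /=; rewrite negbK.
rewrite kE gE; elim: s {g sE gE kE} => [|x s IH]; first by rewrite big_nil mulr1.
rewrite big_cons IH /arc_weight /=; case: eqP => _ /=; rewrite add0n add1n exprS.
  by rewrite mulrCA.
by rewrite mulrA.
Qed.

(** Cancelling [w * w^* = 1] leaves the cycle weight as the [m]-th power of [w^*] or of [w],
    according to which direction has fewer negative arcs. Both cases give the same product with the
    conjugate. *)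
Lemma det_ext_lap_unicyclic (s := orbit f a)
    (m := (size s - 2 * minn (neg_arcs E' s) (size s - neg_arcs E' s))%N) :
  \det (fun_mx (ext_id C lap)) = (1 - w ^+ m) * (1 - w^* ^+ m).
Proof.
rewrite det_ext_lap_cycle cycle_weight_neg_arcs -/s.
have gs : (neg_arcs E' s <= size s)%N by exact: count_size.
rewrite {}/m; move: (neg_arcs E' s) (size s) gs => g k gk.
rewrite rmorphB rmorph1 rmorphM !rmorphXn /= conjCK.
have w_unit' : w^* * w = 1 by rewrite mulrC.
case: (leqP g (k - g)) => h.
  have -> : (k - g = g + (k - 2 * g))%N by lia.
  rewrite exprD mulrA -exprMn w_unit expr1n mul1r.
  by rewrite exprD mulrA -exprMn w_unit' expr1n mul1r mulrC.
have {1 3}-> : (g = (k - g) + (k - 2 * (k - g)))%N by lia.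
rewrite [w ^+ _]exprD mulrAC -exprMn w_unit expr1n mul1r.
by rewrite [w^* ^+ (_ + _)]exprD mulrAC -exprMn w_unit' expr1n mul1r.
Qed.

End RootedDet.
End Laplacian.

(** * Roots of unity *)

(** Cancel ['X - 1] in the factorization of ['X^n - 1] and evaluate the quotient, a geometric sum,
    at 1. *)
Lemma prod_one_sub_prim_root (F : fieldType) (n : nat) (z : F) :
  n.-primitive_root z -> \prod_(1 <= i < n) (1 - z ^+ i) = n%:R.
Proof.
move=> zP; have n0 := prim_order_gt0 zP.
have := factor_Xn_sub_1 zP; rewrite subrX1 big_ltn // expr0 polyC1.
have X1 : 'X - 1 != 0 :> {poly F} by rewrite -polyC1 polyXsubC_eq0.
move/(mulfI X1)/(congr1 (fun P => P.[1])).
rewrite horner_prod horner_sum.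
under eq_bigr do rewrite hornerXsubC.
move=> ->; under eq_bigr do rewrite hornerXn expr1n.
by rewrite sumr_const card_ord.
Qed.

Section Omega.
Variable R : realType.
Local Notation C := R[i].

Definition cis (x : R) : C := (cos x +i* sin x)%C.

Lemma cisD x y : cis (x + y) = cis x * cis y.
Proof. by rewrite /cis; simpc; rewrite cosD sinD [X in (_ +i* X)%C = _]addrC. Qed.

Lemma cisX x n : cis (x * n%:R) = cis x ^+ n.
Proof.
elim: n => [|n IH]; first by rewrite mulr0 /cis cos0 sin0.
by rewrite -natr1 mulrDr mulr1 cisD IH exprSr.
Qed.

Lemma omegaE p q : omega R p q = cis (2 * pi * q%:R / p%:R).
Proof. by rewrite /omega /cis; simpc. Qed.

Lemma omegaX p q : omega R p q = omega R p 1 ^+ q.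
Proof. by rewrite !omegaE -cisX mulr1 mulrAC. Qed.

Lemma omega_unit p q : omega R p q * (omega R p q)^* = 1.
Proof.
rewrite omegaE /cis /Num.conj /=; simpc.
by rewrite -!expr2 cos2Dsin2 mulrC addNr.
Qed.

Lemma omega_prim p : prime p -> odd p -> p.-primitive_root (omega R p 1).
Proof.
move=> pp podd; have p0 := prime_gt0 pp.
have p3 : (2 < p)%N by rewrite odd_prime_gt2.
have wp : omega R p 1 ^+ p = 1.
  rewrite -omegaX omegaE mulfK ?pnatr_eq0 -?lt0n //.
  by rewrite /cis mulr_natl cos2pi sin2pi.
have [k kP kp] := prim_order_exists p0 wp.
have /primeP[_ /(_ k kp) /orP[/eqP k1|/eqP kE]] := pp; last by rewrite -{1}kE.
(* Order 1 would make the imaginary part sin(2 pi / p) vanish, yet 2 pi / p lies strictly between 0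
   and pi since p > 2. *)
have := prim_expr_order kP; rewrite k1 expr1 omegaE mulr1.
move/(congr1 (@complex.Im R)) => /= s0.
suff : 0 < sin (2 * pi / p%:R : R) by rewrite s0 ltxx.
apply: sin_gt0_pi; apply/andP; split.
  by apply: divr_gt0; [apply: mulr_gt0; [rewrite ltr0n | exact: pi_gt0] | rewrite ltr0n].
rewrite ltr_pdivrMr ?ltr0n // mulrC ltr_pM2l ?pi_gt0 //.
by rewrite ltr_nat.
Qed.

End Omega.

Section CyclotomicProduct.
Variables (R : realType) (p m : nat).
Hypotheses (pp : prime p) (podd : odd p) (pm : ~~ (p %| m)%N).

(** With [z] the [m]-th power of [omega R p 1], still primitive, the two factors are [1 - z ^+ q]
    and [1 - z ^+ (p - q)]. The exponents [q] and [p - q] together run once through 1, ..., p -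
    1. *)
Lemma prod_omega_pair :
  \prod_(1 <= q < (p.-1)./2.+1)
    ((1 - omega R p q ^+ m) * (1 - (omega R p q)^* ^+ m)) = p%:R.
Proof.
have zeP := omega_prim R pp podd; set ze := omega R p 1 in zeP.
have zP : p.-primitive_root (ze ^+ m).
  by rewrite (prim_root_exp_coprime _ zeP) coprime_sym prime_coprime.
rewrite -(prod_one_sub_prim_root zP).
set z := ze ^+ m in zP *; set h := (p.-1)./2.
have pE : p = (h.*2.+1)%N.
  have := odd_double_half p; rewrite podd /h => <-.
  by rewrite add1n /= doubleK.
rewrite [RHS](big_cat_nat (n := h.+1)) //=; last by rewrite pE; lia.
rewrite big_split /=; congr (_ * _).
  by apply: eq_bigr => q _; rewrite omegaX -exprM mulnC exprM.
have conjE q : (1 <= q <= p)%N -> (omega R p q)^* ^+ m = z ^+ (p - q).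
  move=> /andP[q0 qp]; rewrite -exprM mulnC exprM; congr (_ ^+ m).
  have wq : omega R p q \is a GRing.unit.
    by apply/unitrP; exists (omega R p q)^*; rewrite mulrC omega_unit.
  apply: (mulrI wq); rewrite omega_unit omegaX -exprD subnKC //.
  by rewrite (prim_expr_order zeP).
(* Reversal replaces [q] by [h + 1 - q], and [p - (h + 1 - q) = q + h] because [p = 2h + 1]. *)
rewrite [LHS]big_nat_rev /= -[in RHS](add1n h) big_addn.
have -> : (p - h = h.+1)%N by rewrite pE; lia.
apply: eq_big_nat => q qh; rewrite conjE; last by rewrite pE; lia.
by congr (1 - _ ^+ _); rewrite pE; lia.
Qed.

End CyclotomicProduct.

(** * Assembling the components *)

Section ComponentProduct.
Variables (R : realType) (p : nat) (V : finType) (V' : {set V}).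
Variable E' : {set V * V}.
Hypotheses (pp : prime p) (podd : odd p) (ori : oriented_graph E').

Lemma det_hlap_components (w : R[i]) : \det (hlap w V' E')
  = \prod_(C in components V' E') \det (fun_mx (ext_id C (lap E' w))).
Proof.
transitivity (\det (fun_mx (ext_id V' (lap E' w)))).
  by rewrite -det_sub_ext_id.
rewrite -{1}[V'](bigcup_components V' E').
rewrite det_ext_id_bigcup ?enum_uniq ?big_enum //.
  by move=> A B; rewrite !mem_enum; exact: components_disjoint.
move=> A B; rewrite !mem_enum => Ac Bc AB u v uA vB.
have dAB := components_disjoint Ac Bc AB.
have vA : v \in A = false by rewrite (disjointFl dAB vB).
have : ~~ joined E' u v.
  apply: contraFN vA; apply: (component_closed Ac uA).
  exact: (subsetP (component_sub Bc)).
rewrite /joined negb_or /lap => /andP[/negbTE-> /negbTE->].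
by case: eqP => // uv; rewrite -uv uA in vA.
Qed.

(** Whether [f a] lies in [C] decides both whether [C] is unicyclic and which determinant formula
    applies. *)
Lemma prod_det_component C : C \in components V' E' ->
  #|C| = #|comp_arcs E' C| ->
  (unicyclic V' E' C -> ~ p_vanishing p V' E' C) ->
  \prod_(1 <= q < (p.-1)./2.+1)
    \det (fun_mx (ext_id C (lap E' (omega R p q))))
  = if `[< unicyclic V' E' C >] then p%:R else 1.
Proof.
move=> Cc cardC nv.
have [a [f [phi [d rC]]]] := comp_rooted Cc cardC.
have unit q := omega_unit R p q.
have [faC|faC] := boolP (f a \in C); last first.
  rewrite asboolF; last exact: (rooted_external_not_unicyclic rC faC).
  by apply: big1 => q _; exact: (det_ext_lap_external ori (unit q) rC).
have uC := rooted_unicyclic ori rC faC Cc.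
rewrite asboolT //.
under eq_bigr do rewrite (det_ext_lap_unicyclic ori (unit _) rC faC).
apply: prod_omega_pair => //; apply/negP => dvd; apply: (nv uC).
by split=> //; exists (orbit f a); split=> //; exact: (rooted_is_cycle ori rC faC).
Qed.

End ComponentProduct.

Theorem mainTheorem16 (R : realType) (p : nat) (V : finType)
    (E : {set V * V}) (V' : {set V}) (E' : {set V * V}) :
  prime p -> odd p ->
  oriented_graph E -> E' \subset E ->
  all_regular V' E' ->
  (forall C : {set V}, unicyclic V' E' C -> ~ p_vanishing p V' E' C) ->
  \prod_(1 <= q < (p.-1)./2.+1) \det (hlap (omega R p q) V' E')
    = (p ^ n_unicyclic V' E')%:R.
Proof.
move=> pp podd oriE sEE reg nv.
have ori : oriented_graph E'.
  move=> u v uvE; have [uv vuE] := oriE u v (subsetP sEE _ uvE).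
  by split=> //; apply: contra vuE; exact: (subsetP sEE).
under eq_bigr do rewrite det_hlap_components //.
(* With the product over components outermost, each component contributes its own factor [p] or
   1. *)
rewrite exchange_big /=.
under eq_bigr => C Cc do
  rewrite (prod_det_component R pp podd ori Cc (reg C Cc) (@nv C)).
rewrite -big_mkcondr /= natrX prodr_const; congr (_ ^+ _).
by apply: eq_card => C; rewrite !inE.
Qed.
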